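(* Let $Q\subset\mathbb R^n$ be a convex compact set, let $\psi:Q\times Q\to\mathbb R$ satisfy $\psi(x,y)+\psi(y,x)\le0$ for all $x,y\in Q$, and suppose that $\psi$ has a $(\delta,L,V)$-model $\psi_\delta$ with $\delta>0$, $L>0$. Let $\{w_k\},\{z_k\},\{L_k\}$ be generated by the generalized mirror prox method described in the context, with accuracy $\varepsilon>0$, initial guess $L_0>0$ and auxiliary accuracy $\widetilde\delta\ge0$. Let $S_N=\sum_{k=0}^{N-1}\frac1{L_{k+1}}$ and $\widehat w_N=\frac1{S_N}\sum_{k=0}^{N-1}\frac{w_k}{L_{k+1}}$. Then $$-\frac1{S_N}\sum_{k=0}^{N-1}\frac{\psi_\delta(x,w_k)}{L_{k+1}}\le\frac{V[z_0](x)}{S_N}+\delta+2\widetilde\delta\qquad\forall x\in Q.$$ Moreover, $$\max_{u\in Q}\psi(\widehat w_N,u)\le\frac{2L\max_{u\in Q}V[z_0](u)}{N}+3\delta+2\widetilde\delta,$$ and the method stops in no more than $$\left\lceil\frac{2L\max_{u\in Q}V[z_0](u)}{\varepsilon}\right\rceil$$ iterations.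
   Context: The abstract variational inequality is: find $x_*\in Q$ with $\psi(x,x_* )\ge0$ for all $x\in Q$; a solution is assumed to exist. $d$ is a convex function on $Q$, continuously differentiable on the relative interior $\mathrm{ri}\,Q$, and $V[y](x)=d(x)-d(y)-\langle\nabla d(y),x-y\rangle$ for $x\in Q$, $y\in\mathrm{ri}\,Q$ ($d$ need not be strongly convex). Whenever $V[y](x)$ is written, $y$ is understood to be a point for which it is defined. $\psi$ has a $(\delta,L,V)$-model $\psi_\delta:Q\times Q\to\mathbb R$ if for all $x,y,z\in Q$: (i) $\psi(x,y)\le\psi_\delta(x,y)+\delta$; (ii) $\psi_\delta(x,y)$ is convex in $x$; (iii) $\psi_\delta(x,x)=0$; (iv) $\psi_\delta(x,y)+\psi_\delta(y,x)\le\delta$; (v) $\psi_\delta(x,y)\le\psi_\delta(x,z)+\psi_\delta(z,y)+LV[z](x)+LV[y](z)+\delta$. Inexact minimization: for convex $\Psi$ and $\widetilde\delta\ge0$, $\operatorname{argmin}^{\widetilde\delta}_{x\in Q}\Psi(x)$ denotes some point $\widetilde x\in Q$ for which there exists $h\in\partial\Psi(\widetilde x)$ with $\langle h,x-\widetilde x\rangle\ge-\widetilde\delta$ for all $x\in Q$. Generalized mirror prox: input $\varepsilon>0$, $\delta>0$, initial guess $L_0>0$, $d$ and $V$. Set $z_0=\operatorname{argmin}_{u\in Q}d(u)$. For $k=0,1,2,\dots$: find the smallest integer $i_k\ge0$ such that, with $L_{k+1}=2^{i_k-1}L_k$, $$w_k=\operatorname{argmin}^{\widetilde\delta}_{x\in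 Q}\{\psi_\delta(x,z_k)+L_{k+1}V[z_k](x)\},\qquad z_{k+1}=\operatorname{argmin}^{\widetilde\delta}_{x\in Q}\{\psi_\delta(x,w_k)+L_{k+1}V[z_k](x)\},$$ one has $$\psi_\delta(z_{k+1},z_k)\le\psi_\delta(z_{k+1},w_k)+\psi_\delta(w_k,z_k)+L_{k+1}\left(V[z_k](w_k)+V[w_k](z_{k+1})\right)+\delta.$$ The method stops once $S_N=\sum_{k=0}^{N-1}\frac1{L_{k+1}}\ge\frac{\max_{x\in Q}V[z_0](x)}{\varepsilon}$ and outputs $\widehat w_N$.
   Formalization: The bound on max ψ(ŵ_N,u) and the iteration bound are proved under the added condition L_0 ≤ 4L, without which they fail (for example when L_0 is very large compared with L); the first inequality is proved for every L_0 > 0. *)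

(* Defs.v *)
From HB Require Import structures.
From mathcomp Require Import all_boot all_order all_algebra.
From mathcomp Require Import all_classical all_reals all_analysis.

Set Implicit Arguments.
Unset Strict Implicit.
Unset Printing Implicit Defensive.
Import Order.TTheory GRing.Theory Num.Theory.
Import numFieldNormedType.Exports.
Local Open Scope classical_set_scope.
Local Open Scope ring_scope.

(* Functions on Q are total functions on 'rV[R]_n of which only the values on
   Q are ever constrained or used. *)

Definition dotr (R : realType) (n : nat) (u v : 'rV[R]_n) : R :=
  \sum_(i < n) u ord0 i * v ord0 i.

Definition affine_hull (R : realType) (n : nat) (Q : set 'rV[R]_n) :
    set 'rV[R]_n :=
  [set y | exists (m : nat) (a : 'I_m -> R) (p : 'I_m -> 'rV[R]_n),
     [/\ forall i, Q (p i), \sum_(i < m) a i = 1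
       & y = \sum_(i < m) a i *: p i]].

Definition relint (R : realType) (n : nat) (Q : set 'rV[R]_n) :
    set 'rV[R]_n :=
  [set y | Q y /\ \forall x \near y, affine_hull Q x -> Q x].

(* Differentiability is taken relatively to Q, which may have empty interior.
   A gradient is then unique only up to vectors orthogonal to the direction
   space of Q; the Bregman divergence below does not depend on the choice. *)
Definition continuously_differentiable_ri (R : realType) (n : nat)
    (Q : set 'rV[R]_n) (d : 'rV[R]_n -> R) (grad : 'rV[R]_n -> 'rV[R]_n) :
    Prop :=
  (forall y, relint Q y -> forall e : R, 0 < e ->
     \forall x \near within Q (nbhs y),
       `|d x - d y - dotr (grad y) (x - y)| <= e * `|x - y|)
  /\ {within relint Q, continuous grad}.

(* bregman d grad y x is V[y](x): the base point comes first. *)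
Definition bregman (R : realType) (n : nat) (d : 'rV[R]_n -> R)
    (grad : 'rV[R]_n -> 'rV[R]_n) (y x : 'rV[R]_n) : R :=
  d x - d y - dotr (grad y) (x - y).

(* In the last condition y and z are base points of V, hence in relint Q. *)
Record is_model (R : realType) (n : nat) (Q : set 'rV[R]_n)
    (V psi psid : 'rV[R]_n -> 'rV[R]_n -> R) (delta L : R) : Prop := IsModel {
  model_upper : forall x y, Q x -> Q y -> psi x y <= psid x y + delta ;
  model_convex : forall y, Q y -> convex_function Q (psid ^~ y) ;
  model_diag : forall x, Q x -> psid x x = 0 ;
  model_monotone : forall x y, Q x -> Q y -> psid x y + psid y x <= delta ;
  model_smooth : forall x y z, Q x -> relint Q y -> relint Q z ->
    psid x y <= psid x z + psid z y + L * V z x + L * V y z + delta }.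

Definition subdifferential (R : realType) (n : nat) (Q : set 'rV[R]_n)
    (Psi : 'rV[R]_n -> R) (x0 : 'rV[R]_n) : set 'rV[R]_n :=
  [set h | forall x, Q x -> Psi x0 + dotr h (x - x0) <= Psi x].

Definition inexact_argmin (R : realType) (n : nat) (Q : set 'rV[R]_n)
    (dt : R) (Psi : 'rV[R]_n -> R) : set 'rV[R]_n :=
  [set x0 | Q x0 /\ exists2 h, subdifferential Q Psi x0 h
                             & forall x, Q x -> - dt <= dotr h (x - x0)].

(* The two auxiliary points computed from zk with trial constant Lk. They are
   not unique, so this is a relation; zk and w occur as base points of V. *)
Definition trial_points (R : realType) (n : nat) (Q : set 'rV[R]_n)
    (V psid : 'rV[R]_n -> 'rV[R]_n -> R) (dt Lk : R) (zk w z : 'rV[R]_n) :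
    Prop :=
  [/\ relint Q zk, relint Q w,
      inexact_argmin Q dt (fun x => psid x zk + Lk * V zk x) w
    & inexact_argmin Q dt (fun x => psid x w + Lk * V zk x) z].

Definition acceptance_test (R : realType) (n : nat)
    (V psid : 'rV[R]_n -> 'rV[R]_n -> R) (delta Lk : R) (zk w z : 'rV[R]_n) :
    bool :=
  psid z zk <= psid z w + psid w zk + Lk * (V zk w + V w z) + delta.

(* i is the smallest exponent in the sense of the backtracking procedure: for
   every smaller j, the points computed with the j-th constant failed the
   test. *)
Definition mirror_prox_step (R : realType) (n : nat) (Q : set 'rV[R]_n)
    (V psid : 'rV[R]_n -> 'rV[R]_n -> R) (delta dt Lk Lk1 : R)
    (zk wk zk1 : 'rV[R]_n) : Prop :=
  exists i : nat,
    [/\ Lk1 = 2 ^ (i%:Z - 1) * Lk,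
        trial_points Q V psid dt Lk1 zk wk zk1,
        acceptance_test V psid delta Lk1 zk wk zk1
      & forall j : nat, (j < i)%N -> exists w z : 'rV[R]_n,
          let Lj := 2 ^ (j%:Z - 1) * Lk in
          trial_points Q V psid dt Lj zk w z /\
          ~~ acceptance_test V psid delta Lj zk w z].

Definition step_sum (R : realType) (Ls : nat -> R) (N : nat) : R :=
  \sum_(k < N) (Ls k.+1)^-1.

Definition averaged_point (R : realType) (n : nat) (Ls : nat -> R)
    (w : nat -> 'rV[R]_n) (N : nat) : 'rV[R]_n :=
  (step_sum Ls N)^-1 *: \sum_(k < N) (Ls k.+1)^-1 *: w k.

Definition stopping_criterion (R : realType) (Ls : nat -> R) (M eps : R)
    (N : nat) : bool :=
  M / eps <= step_sum Ls N.

(* Maximum over Q, as a supremum in the extended reals: the functions at hand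
   need not be continuous on Q, and sup is the max whenever it is attained. *)
Definition max_over (R : realType) (n : nat) (Q : set 'rV[R]_n)
    (f : 'rV[R]_n -> R) : \bar R :=
  ereal_sup [set (f x)%:E | x in Q].

(* Main.v *)
Require Import Defs.
From HB Require Import structures.
From mathcomp Require Import all_boot all_order all_algebra.
From mathcomp Require Import all_classical all_reals all_analysis.
From mathcomp Require Import ring lra.

Set Implicit Arguments.
Unset Strict Implicit.
Unset Printing Implicit Defensive.
Import Order.TTheory GRing.Theory Num.Theory.
Import numFieldNormedType.Exports.
Local Open Scope classical_set_scope.
Local Open Scope ring_scope.

(* Adding the three-point inequalities for w_k and z_{k+1} to the acceptance test
   cancels every model value except psid(x, w_k), so that
     - psid(x, w_k) / L_{k+1}
       <= V[z_k](x) - V[z_{k+1}](x) + (delta + 2 dt) / L_{k+1},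
   which telescopes; at the last iterate the inequality is kept without the term
   V[z_N](x). Convexity (Jensen) and approximate monotonicity of the model turn
   this into the bound on psi. The test succeeds whenever the trial constant is
   at least L, so L_{k+1} <= 2 L and S_N >= N / (2 L). *)

(** * Convexity along segments and Jensen's inequality *)

Lemma dotrDr (R : realType) (n : nat) (u v v' : 'rV[R]_n) :
  dotr u (v + v') = dotr u v + dotr u v'.
Proof.
by rewrite /dotr -big_split; apply: eq_bigr => i _; rewrite mxE mulrDr.
Qed.

Lemma dotrZr (R : realType) (n : nat) (t : R) (u v : 'rV[R]_n) :
  dotr u (t *: v) = t * dotr u v.
Proof.
by rewrite /dotr big_distrr; apply: eq_bigr => i _; rewrite mxE mulrCA.
Qed.

Lemma conv_segment (R : realType) (n : nat) (t : {i01 R}) (x y : 'rV[R]_n) :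
  conv t (x : convex_lmodType 'rV[R]_n) y = y + t%:num *: (x - y).
Proof.
rewrite [LHS](_ : _ = t%:num *: x + (1 - t%:num) *: y)//.
by rewrite scalerBl scalerBr scale1r addrC -addrA [in RHS](addrC (_ *: x)).
Qed.

Lemma convex_set_segment (R : realType) (n : nat) (Q : set 'rV[R]_n)
    (x y : 'rV[R]_n) (t : R) :
  convex_set Q -> Q x -> Q y -> 0 <= t -> t <= 1 -> Q (y + t *: (x - y)).
Proof.
move=> cQ Qx Qy t0 t1.
have := cQ x y (Itv01 t0 t1); rewrite !inE => /(_ Qx Qy).
by rewrite conv_segment.
Qed.

Lemma convex_function_segment (R : realType) (n : nat) (Q : set 'rV[R]_n)
    (f : 'rV[R]_n -> R) (x y : 'rV[R]_n) (t : R) :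
  convex_function Q f -> Q x -> Q y -> 0 <= t -> t <= 1 ->
  f (y + t *: (x - y)) <= f y + t * (f x - f y).
Proof.
move=> cf Qx Qy t0 t1.
have := cf (Itv01 t0 t1) x y; rewrite !inE => /(_ Qx Qy).
rewrite conv_segment convRE /= /unstable.onem; lra.
Qed.

(** By induction: adding a point of weight [b] moves the average along the segment towards it by the
    fraction [b / (S + b)], so two-point convexity suffices. Membership in [Q] is carried along
    because [f] is convex only there. *)
Lemma jensen_sum (R : realType) (n : nat) (Q : set 'rV[R]_n)
    (f : 'rV[R]_n -> R) (a : nat -> R) (p : nat -> 'rV[R]_n) (N : nat) :
  convex_set Q -> convex_function Q f ->
  (forall k, (k <= N)%N -> 0 < a k) -> (forall k, (k <= N)%N -> Q (p k)) ->
  let S := \sum_(k < N.+1) a k in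
  Q (S^-1 *: \sum_(k < N.+1) a k *: p k) /\
  f (S^-1 *: \sum_(k < N.+1) a k *: p k)
    <= S^-1 * \sum_(k < N.+1) a k * f (p k).
Proof.
move=> cQ cf; elim: N => [|N IH] a0 Qp /=.
  have a00 : a 0%N != 0 by rewrite gt_eqF ?a0.
  rewrite !big_ord1 scalerA !mulrA mulVf// scale1r mul1r.
  by split=> //; exact: Qp.
have [] := IH (fun k kN => a0 k (leqW kN)) (fun k kN => Qp k (leqW kN)).
have : 0 < \sum_(k < N.+1) a k.
  rewrite big_ord_recr/= ltr_wpDl ?a0// sumr_ge0// => k _.
  exact/ltW/a0/(leq_trans (ltnW (ltn_ord k)))/leqnSn.
rewrite !(big_ord_recr N.+1)/=.
set S := \sum_(k < _) a k; set P := \sum_(k < _) a k *: p k.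
set F := \sum_(k < _) a k * f (p k) => S0 QP fP.
have b0 := a0 _ (leqnn N.+1); have Qb := Qp _ (leqnn N.+1).
move: (a N.+1) (p N.+1) b0 Qb => b q b0 Qq.
have Sb0 : 0 < S + b by rewrite addr_gt0.
have t0 : 0 <= b / (S + b) by rewrite ltW// divr_gt0.
have t1 : b / (S + b) <= 1 by rewrite ler_pdivrMr// mul1r lerDr ltW.
have -> : (S + b)^-1 *: (P + b *: q)
    = S^-1 *: P + (b / (S + b)) *: (q - S^-1 *: P).
  rewrite scalerBr scalerDr !scalerA [RHS]addrCA [RHS]addrC.
  congr (_ + _); last by rewrite mulrC.
  rewrite -scaleNr -scalerDl; congr (_ *: _).
  by field; rewrite !gt_eqF.
split; first exact: convex_set_segment cQ Qq QP t0 t1.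
apply: (le_trans (convex_function_segment cf Qq QP t0 t1)).
have -> : (S + b)^-1 * (F + b * f q)
    = (1 - b / (S + b)) * (S^-1 * F) + b / (S + b) * f q.
  by field; rewrite !gt_eqF.
have : (1 - b / (S + b)) * f (S^-1 *: P) <= (1 - b / (S + b)) * (S^-1 * F).
  by rewrite ler_wpM2l// subr_ge0.
by lra.
Qed.

(** * First-order expansions and Bregman divergences *)

Lemma directional_expansion (R : realType) (n : nat) (Q : set 'rV[R]_n)
    (d : 'rV[R]_n -> R) (grad : 'rV[R]_n -> 'rV[R]_n) (x y : 'rV[R]_n)
    (e : R) :
  convex_set Q -> continuously_differentiable_ri Q d grad ->
  relint Q y -> Q x -> 0 < e ->
  exists t, [/\ 0 < t, t <= 1 &
    `|d (y + t *: (x - y)) - d y - t * dotr (grad y) (x - y)| <= t * e].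
Proof.
move=> cQ [diffd _] riy Qx e0.
(* The summand 1 keeps the divisor positive when [x = y]. *)
have c0 : 0 < 1 + `|x - y| by rewrite ltr_wpDr.
have := diffd y riy (e / (1 + `|x - y|)) (divr_gt0 e0 c0).
rewrite near_withinE => /nbhs_normP[r /= r0 near_y].
(* The bound 1 keeps the point on the segment, hence in [Q]; [r / 2] puts it strictly inside the
   ball of radius [r]. *)
pose t := Num.min 1 (r / 2 / (1 + `|x - y|)).
have t0 : 0 < t by rewrite lt_min ltr01 !divr_gt0.
have t1 : t <= 1 by rewrite ge_min lexx.
have tr : t * (1 + `|x - y|) <= r / 2 by rewrite -ler_pdivlMr// ge_min lexx orbT.
exists t; split=> //.
have := near_y (y + t *: (x - y)).
have -> : y + t *: (x - y) - y = t *: (x - y) by rewrite addrAC subrr add0r.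
rewrite /= opprD addNKr normrN normrZ (gtr0_norm t0) dotrZr.
move=> H; apply: le_trans (H _ _) _.
- by nra.
- exact: convex_set_segment cQ Qx riy.1 (ltW t0) t1.
- rewrite mulrCA ler_pM2l// mulrAC ler_pdivrMr// ler_pM2l//.
  by rewrite lerDr.
Qed.

(** Convexity bounds the increment of [d] along the segment from above, the expansion bounds it from
    below up to [t * e]; divide by [t] and use that [e] is arbitrary. *)
Lemma bregman_ge0 (R : realType) (n : nat) (Q : set 'rV[R]_n)
    (d : 'rV[R]_n -> R) (grad : 'rV[R]_n -> 'rV[R]_n) (x y : 'rV[R]_n) :
  convex_set Q -> convex_function Q d ->
  continuously_differentiable_ri Q d grad ->
  relint Q y -> Q x -> 0 <= bregman d grad y x.
Proof.
move=> cQ cd diffd riy Qx; apply/ler_addgt0Pr => e e0.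
have [t [t0 t1]] := directional_expansion cQ diffd riy Qx e0.
rewrite ler_norml => /andP[dlo _].
have dseg := convex_function_segment cd Qx riy.1 (ltW t0) t1.
by rewrite -(pmulr_rge0 _ t0) /bregman; lra.
Qed.

(* The subgradient inequality is tested only along the segment [w, x]; dividing
   by its length, the first-order expansion of V turns the divergence
   difference into the extra term V[w](x), which plays the role of strong
   convexity. *)
Lemma inexact_argmin_three_point (R : realType) (n : nat) (Q : set 'rV[R]_n)
    (d : 'rV[R]_n -> R) (grad : 'rV[R]_n -> 'rV[R]_n) (f : 'rV[R]_n -> R)
    (dt l : R) (y w x : 'rV[R]_n) :
  let V := bregman d grad in
  convex_set Q -> continuously_differentiable_ri Q d grad ->
  convex_function Q f -> 0 < l -> relint Q w ->
  inexact_argmin Q dt (fun u => f u + l * V y u) w -> Q x ->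
  f w + l * (V y w + V w x) <= f x + l * V y x + dt.
Proof.
move=> V cQ diffd cf l0 riw [Qw [h subh hdt]] Qx; apply/ler_addgt0Pr => e e0.
(* Accuracy [e / l], since the divergence enters with the factor [l]. *)
have [t [t0 t1]] := directional_expansion cQ diffd riw Qx (divr_gt0 e0 l0).
rewrite ler_norml => /andP[_ dup].
have fseg := convex_function_segment cf Qx Qw (ltW t0) t1.
have := subh _ (convex_set_segment cQ Qx Qw (ltW t0) t1).
have {hdt} := hdt _ Qx.
rewrite /V /bregman.
(* Everything is expressed through [w - y] and [x - w], which makes the identity [V y x - V y w - V
   w x = dotr (grad w - grad y) (x - w)] linear in the inner products. *)
have -> : w + t *: (x - w) - w = t *: (x - w) by rewrite addrAC subrr add0r.
have -> : w + t *: (x - w) - y = (w - y) + t *: (x - w) by rewrite addrAC.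
have -> : x - y = (w - y) + (x - w) by rewrite [RHS]addrC addrA subrK.
rewrite !(dotrDr _ (w - y)) !dotrZr.
move: (dotr h _) (dotr (grad y) _) (dotr (grad y) _) (dotr (grad w) _) dup fseg.
move=> hx gyw gyx gw dup fseg hdt sub.
have dup' : l * (d (w + t *: (x - w)) - d w - t * gw) <= t * e.
  by rewrite -ler_pdivlMl// mulrCA [l^-1 * _]mulrC.
have thdt : t * - dt <= t * hx by rewrite ler_pM2l.
rewrite -(ler_pM2l t0).
by nra.
Qed.

Lemma inexact_argmin_le (R : realType) (n : nat) (Q : set 'rV[R]_n)
    (f : 'rV[R]_n -> R) (dt : R) (w x : 'rV[R]_n) :
  inexact_argmin Q dt f w -> Q x -> f w <= f x + dt.
Proof.
by move=> [Qw [h subh hdt]] Qx; have := subh _ Qx; have := hdt _ Qx; lra.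
Qed.

(** * A single step of the method *)

Section MirrorProx.
Variables (R : realType) (n : nat) (Q : set 'rV[R]_n).
Variables (d : 'rV[R]_n -> R) (grad : 'rV[R]_n -> 'rV[R]_n).
Variables (psi psid : 'rV[R]_n -> 'rV[R]_n -> R) (delta L dt : R).
Let V := bregman d grad.
Hypotheses (cQ : convex_set Q) (cd : convex_function Q d).
Hypothesis diffd : continuously_differentiable_ri Q d grad.
Hypotheses (L0 : 0 < L) (psidP : is_model Q V psi psid delta L).

Lemma acceptance_test_large (l : R) (y w z : 'rV[R]_n) :
  L <= l -> relint Q y -> relint Q w -> Q z ->
  acceptance_test V psid delta l y w z.
Proof.
move=> Ll riy riw Qz; apply: le_trans (model_smooth psidP Qz riy riw) _.
have Vwz : 0 <= V w z by exact: bregman_ge0 riw Qz.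
have Vyw : 0 <= V y w by exact: bregman_ge0 riy riw.1.
rewrite lerD2r -[leLHS]addrA lerD2l -mulrDr [V w z + _]addrC.
exact: ler_wpM2r (addr_ge0 Vyw Vwz) _ _ Ll.
Qed.

Section Step.
Variables (l l' : R) (y w z : 'rV[R]_n).
Hypothesis step : mirror_prox_step Q V psid delta dt l l' y w z.

Lemma mirror_prox_step_gt0 : 0 < l -> 0 < l'.
Proof. by case: step => i [-> _ _ _] l0; rewrite mulr_gt0// exprz_gt0. Qed.

(** Either the first trial passes and the constant is halved, or the accepted constant is twice a
    rejected one, which must be below [L]. *)
Lemma mirror_prox_step_le : l <= 4 * L -> l' <= 2 * L.
Proof.
case: step => -[|j] [-> _ _ fails] lL.
  by rewrite sub0r exprN1; lra.
have [w' [z' /= [[riy riw' _ [Qz' _]]]]] := fails j (ltnSn j).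
have -> : j.+1%:Z - 1 = (j%:Z - 1) + 1 by rewrite subrK intS addrAC subrr add0r.
rewrite (exprzDr _ (_ - 1) 1) ?unitfE// expr1z [_ * 2]mulrC -mulrA ler_pM2l//.
move: (_ * l) => lj; case: (leP L lj) => [Llj|/ltW//].
by rewrite acceptance_test_large.
Qed.

(* [b] is V[z](x) when z is a legitimate base point, and 0 in general: the last
   iterate need not lie in the relative interior. *)
Lemma mirror_prox_step_descent (b : R) (x : 'rV[R]_n) :
  0 < l' -> Q x ->
  psid z w + l' * (V y z + b) <= psid x w + l' * V y x + dt ->
  - (psid x w / l') <= V y x - b + (delta + 2 * dt) / l'.
Proof.
case: step => i [_ [riy riw wmin zmin] test _] l'0 Qx zx.
(* Tested at [z], the inequality for [w] produces exactly the divergences [V y w + V w z] of the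
   acceptance test, so they cancel. *)
have wz := inexact_argmin_three_point cQ diffd (model_convex psidP riy.1) l'0
  riw wmin zmin.1.
rewrite -mulNr ler_pdivrMr// mulrDl mulfVK ?gt_eqF//.
by move: test; rewrite /acceptance_test; rewrite -/V in wz; lra.
Qed.

Lemma mirror_prox_step_descent_relint (x : 'rV[R]_n) :
  0 < l' -> relint Q z -> Q x ->
  - (psid x w / l') <= V y x - V z x + (delta + 2 * dt) / l'.
Proof.
move=> l'0 riz Qx; apply: mirror_prox_step_descent => //.
case: step => i [_ [riy riw _ zmin] _ _].
exact: inexact_argmin_three_point (model_convex psidP riw.1) _ _ zmin _.
Qed.

Lemma mirror_prox_step_descent0 (x : 'rV[R]_n) :
  0 < l' -> Q x -> - (psid x w / l') <= V y x + (delta + 2 * dt) / l'.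
Proof.
move=> l'0 Qx; rewrite -[V y x]subr0; apply: mirror_prox_step_descent => //.
rewrite addr0; case: step => i [_ [_ _ _ zmin] _ _].
exact: inexact_argmin_le zmin _.
Qed.

End Step.

(** * Summation over a run *)

Section Run.
Variables (w z : nat -> 'rV[R]_n) (Ls : nat -> R) (N : nat).
Hypothesis Ls0 : 0 < Ls 0%N.
Hypothesis steps : forall k, (k < N)%N ->
  mirror_prox_step Q V psid delta dt (Ls k) (Ls k.+1) (z k) (w k) (z k.+1).

Lemma Ls_gt0 k : (k <= N)%N -> 0 < Ls k.
Proof.
elim: k => // k IH kN; exact: mirror_prox_step_gt0 (steps kN) (IH (ltnW kN)).
Qed.

Lemma Ls_le k : Ls 0%N <= 4 * L -> (k < N)%N -> Ls k.+1 <= 2 * L.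
Proof.
move=> L04; elim: k => [|k IH] kN; first exact: mirror_prox_step_le (steps kN) _.
apply: mirror_prox_step_le (steps kN) _.
by apply: le_trans (IH (ltnW kN)) _; rewrite ler_pM2r// ler_nat.
Qed.

Lemma step_sum_ge : Ls 0%N <= 4 * L -> N%:R / (2 * L) <= step_sum Ls N.
Proof.
move=> L04; have -> : N%:R / (2 * L) = \sum_(k < N) (2 * L)^-1.
  by rewrite sumr_const card_ord mulr_natl.
apply: ler_sum => k _; rewrite lef_pV2 ?Ls_le// posrE ?Ls_gt0//.
by rewrite mulr_gt0.
Qed.

Lemma step_sum_gt0 : (0 < N)%N -> 0 < step_sum Ls N.
Proof.
rewrite /step_sum; case: N Ls_gt0 => // m Lgt0 _.
rewrite big_ord_recr/= ltr_wpDl ?invr_gt0 ?Lgt0// sumr_ge0// => k _.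
by rewrite invr_ge0 ltW// Lgt0// ltnW// ltnS.
Qed.

Lemma telescoped_descent (m : nat) (x : 'rV[R]_n) :
  (m < N)%N -> Q x ->
  - (\sum_(k < m) psid x (w k) / Ls k.+1)
  <= V (z 0%N) x - V (z m) x + (delta + 2 * dt) * step_sum Ls m.
Proof.
rewrite /step_sum => + Qx; elim: m => [|m IH] mN.
  by rewrite !big_ord0 oppr0 subrr mulr0 addr0.
(* Step [m.+1] is still performed and takes [z m.+1] as its base point; this is why [m < N] is
   strict. *)
have riz : relint Q (z m.+1) by case: (steps mN) => i [_ []].
have := mirror_prox_step_descent_relint (steps (ltnW mN)) (Ls_gt0 (ltnW mN))
  riz Qx.
by have := IH (ltnW mN); rewrite !big_ord_recr/=; lra.
Qed.

Lemma averaged_gap_le (x : 'rV[R]_n) : (0 < N)%N -> Q x ->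
  - ((step_sum Ls N)^-1 * \sum_(k < N) psid x (w k) / Ls k.+1)
  <= V (z 0%N) x / step_sum Ls N + delta + 2 * dt.
Proof.
move=> N0 Qx; have S0 := step_sum_gt0 N0.
rewrite -addrA -mulrN -(ler_pM2l S0) mulVKf ?gt_eqF//.
rewrite mulrDr mulrCA mulfV ?gt_eqF// mulr1.
have NE : N = N.-1.+1 by rewrite prednK.
have pN : (N.-1 < N)%N by rewrite -NE.
(* The first [N.-1] steps leave [- V (z N.-1) x], which cancels against the last step. *)
have := telescoped_descent pN Qx.
have := mirror_prox_step_descent0 (steps pN) (Ls_gt0 pN) Qx.
by rewrite NE /step_sum !big_ord_recr/= -NE; lra.
Qed.

(** The three [delta] come from the averaged gap, from exchanging the arguments of [psid], and from
    passing from [psi] to [psid]. *)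
Lemma psi_averaged_le (u : 'rV[R]_n) : (0 < N)%N -> Q u ->
  psi (averaged_point Ls w N) u
  <= V (z 0%N) u / step_sum Ls N + 3 * delta + 2 * dt.
Proof.
move=> N0 Qu; have S0 := step_sum_gt0 N0; have gap := averaged_gap_le N0 Qu.
have NE : N = N.-1.+1 by rewrite prednK.
have Qw k : (k < N)%N -> Q (w k) by move=> /steps[i [_ [_ []]]].
have [|||] := @jensen_sum R n Q (psid ^~ u) (fun k => (Ls k.+1)^-1) w N.-1 cQ.
- exact (model_convex psidP Qu).
- by move=> k; rewrite -ltnS -NE => kN; rewrite invr_gt0 Ls_gt0.
- by move=> k; rewrite -ltnS -NE => kN; exact: Qw.
rewrite -NE -/(step_sum Ls N) -/(averaged_point Ls w N) => Qav jensen.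
have flip : \sum_(k < N) (Ls k.+1)^-1 * psid (w k) u
    <= - (\sum_(k < N) psid u (w k) / Ls k.+1) + step_sum Ls N * delta.
  rewrite /step_sum -sumrN big_distrl -big_split; apply: ler_sum => k _ /=.
  have Lk : 0 < (Ls k.+1)^-1 by rewrite invr_gt0 Ls_gt0.
  have mono := model_monotone psidP (Qw _ (ltn_ord k)) Qu.
  by rewrite [_ / _]mulrC -mulrN -mulrDr ler_pM2l//; lra.
have {flip} := ler_wpM2l (ltW (_ : 0 < (step_sum Ls N)^-1)) flip.
rewrite invr_gt0 => /(_ S0); rewrite mulrDr mulKf ?gt_eqF// mulrN => flip.
by have := model_upper psidP Qav Qu; lra.
Qed.

End Run.

End MirrorProx.

Theorem theorem4p8 (R : realType) (n : nat) (Q : set 'rV[R]_n)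
    (d : 'rV[R]_n -> R) (grad : 'rV[R]_n -> 'rV[R]_n)
    (psi psid : 'rV[R]_n -> 'rV[R]_n -> R)
    (delta L eps dt M : R)
    (w z : nat -> 'rV[R]_n) (Ls : nat -> R) :
  let V := bregman d grad in
  convex_set Q -> compact Q ->
  convex_function Q d -> continuously_differentiable_ri Q d grad ->
  (forall x y, Q x -> Q y -> psi x y + psi y x <= 0) ->
  (exists2 xs, Q xs & forall x, Q x -> 0 <= psi x xs) ->
  0 < delta -> 0 < L -> is_model Q V psi psid delta L ->
  0 < eps -> 0 <= dt -> 0 < Ls 0%N ->
  relint Q (z 0%N) -> (forall u, Q u -> d (z 0%N) <= d u) ->
  max_over Q (V (z 0%N)) = M%:E ->
  let step k :=
    mirror_prox_step Q V psid delta dt (Ls k) (Ls k.+1) (z k) (w k) (z k.+1) in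
  (* estimates after any number N >= 1 of performed iterations *)
  (forall N : nat, (0 < N)%N -> (forall k, (k < N)%N -> step k) ->
     (forall x, Q x ->
        - ((step_sum Ls N)^-1 * \sum_(k < N) psid x (w k) / Ls k.+1)
        <= V (z 0%N) x / step_sum Ls N + delta + 2 * dt)
     /\
     (Ls 0%N <= 4 * L ->
      (max_over Q (psi (averaged_point Ls w N))
       <= (2 * L * M / N%:R + 3 * delta + 2 * dt)%:E)%E))
  /\
  (* the method, iterating as long as it has not stopped, stops in time *)
  (Ls 0%N <= 4 * L ->
   (forall k, (forall j, (j <= k)%N -> ~~ stopping_criterion Ls M eps j) ->
      step k) ->
   exists2 N : nat, N%:Z <= Num.ceil (2 * L * M / eps)
                  & stopping_criterion Ls M eps N).
Proof.
move=> V cQ _ cd diffd _ _ _ L0 psidP eps0 _ Ls0 riz0 _ maxM step.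
have VM u : Q u -> V (z 0%N) u <= M.
  move=> Qu; rewrite -lee_fin -maxM.
  by apply: ereal_sup_ubound; exists u.
(* The supremum is compared with the value at [z 0] itself. *)
have M0 : 0 <= M.
  by apply: le_trans (VM _ riz0.1); exact: bregman_ge0 riz0 riz0.1.
split=> [N N0 steps|L04 steps].
  split=> [x Qx|L04]; first
    exact (averaged_gap_le cQ diffd psidP Ls0 steps N0 Qx).
  apply: ge_ereal_sup => _ [u Qu <-]; rewrite lee_fin.
  apply: le_trans (psi_averaged_le cQ diffd psidP Ls0 steps N0 Qu) _.
  rewrite !lerD2r.
  have S0 := step_sum_gt0 Ls0 steps N0.
  have SN := step_sum_ge cQ cd diffd L0 psidP Ls0 steps L04.
  have Np : 0 < N%:R :> R by rewrite ltr0n.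
  have LN0 : 0 < N%:R / (2 * L) by rewrite divr_gt0// mulr_gt0.
  apply: (le_trans (ler_wpM2r _ (VM _ Qu))); first by rewrite invr_ge0 ltW.
  rewrite [2 * L * M]mulrC -mulrA ler_wpM2l//.
  by rewrite -[leRHS]invrK invf_div lef_pV2// posrE.
pose N := `|Num.ceil (2 * L * M / eps)|%N.
have NE : N%:Z = Num.ceil (2 * L * M / eps).
  rewrite gez0_abs// ceil_ge0 (lt_le_trans (ltrN10 R))//.
  by rewrite divr_ge0 ?(ltW eps0)// !mulr_ge0// ltW.
(* If the criterion failed at every index up to [N], all [N] steps would be performed, and [step_sum
   Ls N >= N%:R / (2 * L) >= M / eps] would meet it at [N]. *)
have [[j jN stop]|never] :=
    pselect (exists2 j, (j <= N)%N & stopping_criterion Ls M eps j).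
  by exists j => //; rewrite -NE lez_nat.
have running j : (j <= N)%N -> ~~ stopping_criterion Ls M eps j.
  by move=> jN; apply/negP => stop; apply: never; exists j.
have stepsN k : (k < N)%N -> step k.
  by move=> kN; apply: steps => j jk; rewrite running// (leq_trans jk)// ltnW.
exfalso; apply/negP: (running N (leqnn N)); rewrite /stopping_criterion negbK.
have SN := step_sum_ge cQ cd diffd L0 psidP Ls0 stepsN L04.
apply: le_trans SN; rewrite ler_pdivlMr ?mulr_gt0//.
have := ceil_ge (2 * L * M / eps); rewrite -NE -pmulrn.
by apply: le_trans; rewrite mulrAC [M * _]mulrC.
Qed.
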